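(* Let $\mathcal{T}$ be a first-order theory with domain $\mathbb{D}$ whose $\exists^*\forall^*$-fragment is decidable, let $\varphi_{\mathcal{T}}(\overline{x},\overline{y})$ be a safety $\mathrm{LTL}_{\mathcal{T}}$ specification with literals $l_1,\dots,l_n$, and let $\varphi_{\mathbb{B}}$ be its Boolean abstraction. Let $W=\langle Q,I,T\rangle$ be the winning region of $\varphi_{\mathbb{B}}$, and let $S_{\mathcal{T}}$ be the shield built from $W$ as follows. It maintains a set $Q_{now}\subseteq Q$, initially $I$. At each step, given environment input $v_{\overline{x}}$ and output $v_{\overline{y}}$ proposed by an external controller $D$: the partitioner computes the Boolean input $v_{\overline{e}}$ ($e_r$ true for the unique valid reaction $r$ with $f_r(v_{\overline{x}})$ true); it computes the choice $c=\{s_i\mid l_i(v_{\overline{x}},v_{\overline{y}})\text{ holds}\}$ with Boolean valuation $v_{\overline{s}}$; if there are $q\in Q_{now}$ and $q'$ with $(q',v_{\overline{s}})\in T(q,v_{\overline{e}})$, it outputs $v_{\overline{y}}$ and sets $\overline{v}=v_{\overline{s}}$; otherwise it picks $v_{\overline{s}}'$ (choice $c'$) with $(q',v_{\overline{s}}')\in T(q,v_{\overline{e}})$ for some $q\in Q_{now}$, outputs some $v_{\overline{y}}'$ making $f_r(v_{\overline{x}})\rightarrow f_{c'}(v_{\overline{x}},v_{\overline{y}}')$ true, and sets $\overline{v}=v_{\overline{s}}'$; finally it updates $Q_{now}:=\{q'\mid (q',\overline{v})\in T(q,v_{\overline{e}})\text{ for some }q\in Q_{now}\}$. Then for every external controller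 $D$, every trace produced by $D\cdot S_{\mathcal{T}}$ satisfies $\varphi_{\mathcal{T}}$.
   Context: $\mathrm{LTL}_{\mathcal{T}}$ is LTL where atomic propositions are replaced by literals of $\mathcal{T}$; traces are infinite sequences of valuations of $\overline{x}\cup\overline{y}$ in $\mathbb{D}$, evaluated via the truth values of the literals and the LTL semantics. $\overline{x}$ is controlled by the environment, $\overline{y}$ by the system. A safety formula is one where every violating trace has a finite prefix all of whose extensions violate it. Boolean abstraction: fresh system propositions $s_i$ for $l_i$. A choice $c\subseteq\{s_1,\dots,s_n\}$ (identified with a valuation of $\overline{s}$) has characteristic formula $f_c(\overline{x},\overline{y})=\bigwedge_{s_i\in c}l_i\wedge\bigwedge_{s_i\notin c}\neg l_i$. A reaction $r$ (set of choices) has $f_r(\overline{x})=\bigwedge_{c\in r}\exists\overline{y}.f_c\wedge\bigwedge_{c\notin r}\forall\overline{y}.\neg f_c$; $r$ is valid if $\exists\overline{x}.f_r$ holds in $\mathcal{T}$; every valuation of $\overline{x}$ satisfies $f_r$ for exactly one valid $r$. For each valid $r$ a fresh environment proposition $e_r$; $\varphi^{legal}$ says exactly one $e_r$ is true; $\varphi^{extra}=\bigwedge_r(e_r\rightarrow\bigvee_{c\in r}(\bigwedge_{s_i\in c}s_i\wedge\bigwedge_{s_i\notin c}\neg s_i))$; $\varphi_{\mathbb{B}}=\varphi_{\mathcal{T}}[l_i\leftarrow s_i]\wedge\square(\varphi^{legal}\rightarrow\varphi^{extra})$. A winning region $\langle Q,I,T\rangle$ for a safety LTL formula over environment propositions $\overline{e}$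 and system propositions $\overline{s}$ has $Q$ finite, $I\subseteq Q$ initial states, and $T:Q\times\mathrm{val}(\overline{e})\to 2^{Q\times\mathrm{val}(\overline{s})}$ giving for each state and input all legal (successor, output) pairs; it encompasses all winning moves of the system, every sequence of inputs and outputs following $T$ from $I$ satisfies the formula, and from the states reached every (legal) input has at least one successor. *)

(* Defs.v *)
(* MathComp, with the classical layer of MathComp-Analysis ([boolp]) used only
   to turn propositions into booleans when forming finite sets. *)
From mathcomp Require Import all_boot.
From mathcomp Require Import boolp.

Set Implicit Arguments.
Unset Strict Implicit.
Unset Printing Implicit Defensive.

(* The countType structures number the symbols, so that formulas have codes. *)
Record signature := Signature {
  fsym : countType;
  farity : fsym -> nat;
  psym : countType;
  parity : psym -> nat }.

(* A theory interprets its symbols over one fixed nonempty domain; "holds in T"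
   is truth in this interpretation. *)
Record theory (Sg : signature) := Theory {
  domain :> Type;
  domain_inhabited : inhabited domain;
  finterp : forall f : fsym Sg, (domain ^ farity f)%type -> domain;
  pinterp : forall p : psym Sg, (domain ^ parity p)%type -> Prop }.

(* Variables come in two blocks, x_0 .. x_(m-1) and y_0 .. y_(k-1). *)
Inductive term (Sg : signature) (m k : nat) : Type :=
| XVar of 'I_m
| YVar of 'I_k
| App (f : fsym Sg) of (term Sg m k ^ farity f)%type.

Inductive atom (Sg : signature) (m k : nat) : Type :=
| APred (p : psym Sg) of (term Sg m k ^ parity p)%type
| AEq of term Sg m k & term Sg m k.

(* [Lit true a] is the atom a, [Lit false a] its negation. *)
Inductive literal (Sg : signature) (m k : nat) : Type :=
| Lit of bool & atom Sg m k.

Inductive qf_formula (Sg : signature) (m k : nat) : Type :=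
| QTrue
| QAtom of atom Sg m k
| QNot of qf_formula Sg m k
| QAnd of qf_formula Sg m k & qf_formula Sg m k.

Section Semantics.
Variables (Sg : signature) (T : theory Sg) (m k : nat).
Implicit Types (vx : {ffun 'I_m -> T}) (vy : {ffun 'I_k -> T}).

Fixpoint term_eval vx vy (t : term Sg m k) : T :=
  match t with
  | XVar i => vx i
  | YVar j => vy j
  | App f a => finterp [ffun i => term_eval vx vy (a i)]
  end.

Definition atom_holds vx vy (a : atom Sg m k) : Prop :=
  match a with
  | APred p a => pinterp [ffun i => term_eval vx vy (a i)]
  | AEq t u => term_eval vx vy t = term_eval vx vy u
  end.

Definition lit_holds vx vy (l : literal Sg m k) : Prop :=
  let: Lit b a := l in if b then atom_holds vx vy a else ~ atom_holds vx vy a.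

Fixpoint qf_holds vx vy (psi : qf_formula Sg m k) : Prop :=
  match psi with
  | QTrue => True
  | QAtom a => atom_holds vx vy a
  | QNot psi1 => ~ qf_holds vx vy psi1
  | QAnd psi1 psi2 => qf_holds vx vy psi1 /\ qf_holds vx vy psi2
  end.

End Semantics.

(* Decidability is Turing decidability, by Minsky register machines.  A
   boolean-valued function would not do: under the classical axioms one exists
   for every predicate. *)
Inductive instruction : Type :=
| Inc of nat
| DecOrJump of nat & nat.

Definition set_reg (rs : nat -> nat) (r v : nat) : nat -> nat :=
  fun r' => if r' == r then v else rs r'.

Definition machine_step (p : seq instruction) (s : nat * (nat -> nat)) :=
  let: (pc, rs) := s in
  match onth p pc with
  | Some (Inc r) => (pc.+1, set_reg rs r (rs r).+1)
  | Some (DecOrJump r j) =>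
      if rs r == 0 then (j, rs) else (pc.+1, set_reg rs r (rs r).-1)
  | None => s
  end.

(* Started with x in register 0 and zeros elsewhere, p leaves its code with
   y in register 0. *)
Definition machine_computes (p : seq instruction) (x y : nat) : Prop :=
  exists t : nat,
    let s := iter t (machine_step p) (0, set_reg (fun=> 0) 0 x) in
    size p <= s.1 /\ s.2 0 = y.

Definition turing_decidable (X : Type) (code : X -> nat) (P : X -> Prop) :=
  exists p : seq instruction, forall x : X,
    (P x -> machine_computes p (code x) 1) /\
    (~ P x -> machine_computes p (code x) 0).

Section Codes.
Variables (Sg : signature) (m k : nat).
Local Notation tree := (GenTree.tree nat).

Fixpoint term_tree (t : term Sg m k) : tree :=
  match t with
  | XVar i => GenTree.Node 0 [:: GenTree.Leaf (val i)]
  | YVar j => GenTree.Node 1 [:: GenTree.Leaf (val j)]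
  | App f a => GenTree.Node 2
      [:: GenTree.Leaf (pickle f)
        , GenTree.Leaf (farity f) & codom (fun i => term_tree (a i))]
  end.

Definition atom_tree (a : atom Sg m k) : tree :=
  match a with
  | APred p a => GenTree.Node 0
      [:: GenTree.Leaf (pickle p)
        , GenTree.Leaf (parity p) & codom (fun i => term_tree (a i))]
  | AEq t u => GenTree.Node 1 [:: term_tree t; term_tree u]
  end.

Fixpoint qf_tree (psi : qf_formula Sg m k) : tree :=
  match psi with
  | QTrue => GenTree.Node 0 [::]
  | QAtom a => GenTree.Node 1 [:: atom_tree a]
  | QNot psi1 => GenTree.Node 2 [:: qf_tree psi1]
  | QAnd psi1 psi2 => GenTree.Node 3 [:: qf_tree psi1; qf_tree psi2]
  end.

End Codes.

(* The sentence: exists x_0 .. x_(m-1), forall y_0 .. y_(k-1), matrix. *)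
Record EA_sentence (Sg : signature) := EASentence {
  EA_exists : nat;
  EA_forall : nat;
  EA_matrix : qf_formula Sg EA_exists EA_forall }.

Definition EA_holds (Sg : signature) (T : theory Sg) (A : EA_sentence Sg) :=
  exists vx : {ffun 'I_(EA_exists A) -> T},
  forall vy : {ffun 'I_(EA_forall A) -> T}, qf_holds vx vy (EA_matrix A).

Definition EA_code (Sg : signature) (A : EA_sentence Sg) : nat :=
  pickle (GenTree.Node 0
    [:: GenTree.Leaf (EA_exists A); GenTree.Leaf (EA_forall A);
        qf_tree (EA_matrix A)]).

Definition EA_decidable (Sg : signature) (T : theory Sg) : Prop :=
  turing_decidable (@EA_code Sg) (EA_holds T).

Inductive ltl (A : Type) : Type :=
| LTrue
| LAtom of A
| LNot of ltl A
| LAnd of ltl A & ltl A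
| LNext of ltl A
| LUntil of ltl A & ltl A.

Arguments LTrue {A}.
Arguments LAnd {A} _ _.

Definition LFalse {A} : ltl A := LNot LTrue.
Definition LOr {A} (f g : ltl A) : ltl A := LNot (LAnd (LNot f) (LNot g)).
Definition LImp {A} (f g : ltl A) : ltl A := LOr (LNot f) g.
Definition LAlways {A} (f : ltl A) : ltl A := LNot (LUntil LTrue (LNot f)).

(* [truth i a]: the atomic proposition a is true at instant i. *)
Fixpoint ltl_sat (A : Type) (truth : nat -> A -> Prop) (i : nat) (f : ltl A)
  : Prop :=
  match f with
  | LTrue => True
  | LAtom a => truth i a
  | LNot g => ~ ltl_sat truth i g
  | LAnd g h => ltl_sat truth i g /\ ltl_sat truth i h
  | LNext g => ltl_sat truth i.+1 g
  | LUntil g h =>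
      exists j : nat, [/\ i <= j, ltl_sat truth j h &
        forall j' : nat, i <= j' < j -> ltl_sat truth j' g]
  end.

Fixpoint ltl_occurs (A : Type) (a : A) (f : ltl A) : Prop :=
  match f with
  | LTrue => False
  | LAtom b => b = a
  | LNot g | LNext g => ltl_occurs a g
  | LAnd g h | LUntil g h => ltl_occurs a g \/ ltl_occurs a h
  end.

Fixpoint ltl_subst (A B : Type) (u : A -> ltl B) (f : ltl A) : ltl B :=
  match f with
  | LTrue => LTrue
  | LAtom a => u a
  | LNot g => LNot (ltl_subst u g)
  | LAnd g h => LAnd (ltl_subst u g) (ltl_subst u h)
  | LNext g => LNext (ltl_subst u g)
  | LUntil g h => LUntil (ltl_subst u g) (ltl_subst u h)
  end.

Definition safety (St : Type) (models : (nat -> St) -> Prop) : Prop :=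
  forall sigma : nat -> St, ~ models sigma ->
    exists N : nat, forall sigma' : nat -> St,
      (forall i, i < N -> sigma' i = sigma i) -> ~ models sigma'.

Definition ltlT (Sg : signature) (m k : nat) : Type := ltl (literal Sg m k).

(* A state of a trace: an environment part and a system part. *)
Definition stateT (Sg : signature) (T : theory Sg) (m k : nat) : Type :=
  ({ffun 'I_m -> T} * {ffun 'I_k -> T})%type.

Definition satT (Sg : signature) (T : theory Sg) (m k : nat)
    (sigma : nat -> stateT T m k) (phi : ltlT Sg m k) : Prop :=
  ltl_sat (fun i => lit_holds (sigma i).1 (sigma i).2) 0 phi.

(* E: environment propositions, S: system propositions; a valuation is the set
   of the propositions it makes true. *)
Definition stateB (E S : finType) : Type := ({set E} * {set S})%type.

Definition satB (E S : finType) (tau : nat -> stateB E S) (f : ltl (E + S))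
  : Prop :=
  ltl_sat (fun i p => match p with
                      | inl e => e \in (tau i).1
                      | inr s => s \in (tau i).2
                      end) 0 f.

(* A system strategy maps the inputs so far, the current one included, to an
   output. *)
Definition play (E S : finType) (rho : seq {set E} -> {set S})
    (ve : nat -> {set E}) : nat -> stateB E S :=
  fun i => (ve i, rho (mkseq ve i.+1)).

Definition winning_strategy (E S : finType) (legal : pred {set E})
    (f : ltl (E + S)) (rho : seq {set E} -> {set S}) : Prop :=
  forall ve : nat -> {set E}, (forall i, legal (ve i)) -> satB (play rho ve) f.

Record region (E S : finType) := Region {
  reg_state : finType;
  reg_init : {set reg_state};
  reg_trans : reg_state -> {set E} -> {set reg_state * {set S}} }.

Definition region_run (E S : finType) (W : region E S)
    (q : nat -> reg_state W) (tau : nat -> stateB E S) : Prop :=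
  q 0 \in reg_init W /\
  forall i, (q i.+1, (tau i).2) \in reg_trans (q i) (tau i).1.

Inductive region_reachable (E S : finType) (W : region E S)
  : reg_state W -> Prop :=
| reach_init q : q \in reg_init W -> region_reachable q
| reach_step q q' ve vs :
    region_reachable q -> (q', vs) \in reg_trans q ve -> region_reachable q'.

(* [wr_maximal] says that W encompasses all winning moves: every play of every
   winning strategy is the labelling of a run of W. *)
Record winning_region (E S : finType) (legal : pred {set E})
    (f : ltl (E + S)) (W : region E S) : Prop := WinningRegion {
  wr_sound : forall (q : nat -> reg_state W) (tau : nat -> stateB E S),
    region_run q tau -> satB tau f;
  wr_nonblocking : forall (q : reg_state W) (ve : {set E}),
    region_reachable q -> legal ve -> exists qs, qs \in reg_trans q ve;
  wr_maximal : forall rho : seq {set E} -> {set S},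
    winning_strategy legal f rho ->
    forall ve : nat -> {set E}, (forall i, legal (ve i)) ->
    exists q : nat -> reg_state W, region_run q (play rho ve) }.

Section Abstraction.
Variables (Sg : signature) (T : theory Sg) (m k n : nat).
Variable l : 'I_n -> literal Sg m k.
Implicit Types (vx : {ffun 'I_m -> T}) (vy : {ffun 'I_k -> T}).

(* The proposition s_i is represented by i : 'I_n, so that a choice is a set of
   indices and is also a valuation of the s_i. *)
Definition choice_formula (c : {set 'I_n}) vx vy : Prop :=
  (forall i, i \in c -> lit_holds vx vy (l i)) /\
  (forall i, i \notin c -> ~ lit_holds vx vy (l i)).

Definition reaction_formula (r : {set {set 'I_n}}) vx : Prop :=
  (forall c, c \in r -> exists vy, choice_formula c vx vy) /\
  (forall c, c \notin r -> forall vy, ~ choice_formula c vx vy).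

Definition valid_reaction (r : {set {set 'I_n}}) : Prop :=
  exists vx, reaction_formula r vx.

(* The proposition e_r is represented by r itself, r being a valid reaction. *)
Definition env_prop : finType :=
  {r : {set {set 'I_n}} | `[< valid_reaction r >]}.

Local Notation e_ r := (LAtom (inl r : env_prop + 'I_n)).
Local Notation s_ i := (LAtom (inr i : env_prop + 'I_n)).

Definition phi_legal : ltl (env_prop + 'I_n) :=
  \big[LOr/LFalse]_(r : env_prop)
    LAnd (e_ r) (\big[LAnd/LTrue]_(r' : env_prop | r' != r) LNot (e_ r')).

Definition choice_prop (c : {set 'I_n}) : ltl (env_prop + 'I_n) :=
  LAnd (\big[LAnd/LTrue]_(i in c) s_ i)
       (\big[LAnd/LTrue]_(i | i \notin c) LNot (s_ i)).

Definition phi_extra : ltl (env_prop + 'I_n) :=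
  \big[LAnd/LTrue]_(r : env_prop)
    LImp (e_ r) (\big[LOr/LFalse]_(c in val r) choice_prop c).

(* The substitution [l_i <- s_i]; the default is not reached on literals among
   the l_i. *)
Definition abstract_literal (a : literal Sg m k) : ltl (env_prop + 'I_n) :=
  if [pick i | `[< l i = a >]] is Some i then s_ i else LFalse.

Definition boolean_abstraction (phi : ltlT Sg m k) : ltl (env_prop + 'I_n) :=
  LAnd (ltl_subst abstract_literal phi) (LAlways (LImp phi_legal phi_extra)).

Definition legal_input : pred {set env_prop} := fun ve => #|ve| == 1.

Definition partition_input vx : {set env_prop} :=
  [set r : env_prop | `[< reaction_formula (val r) vx >]].

Definition choice_of vx vy : {set 'I_n} :=
  [set i | `[< lit_holds vx vy (l i) >]].

Variable W : region env_prop 'I_n.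

Definition allowed (Qnow : {set reg_state W}) (ve : {set env_prop})
    (vs : {set 'I_n}) : Prop :=
  exists q q', q \in Qnow /\ (q', vs) \in reg_trans q ve.

Definition update (Qnow : {set reg_state W}) (ve : {set env_prop})
    (vs : {set 'I_n}) : {set reg_state W} :=
  [set q' | [exists q in Qnow, (q', vs) \in reg_trans q ve]].

(* [shield_step Qnow vx vy out Qnext]: from Qnow, on input vx and proposed
   output vy, the shield may output out and move to Qnext.  It is a relation
   because the picks made when overriding vy are arbitrary. *)
Inductive shield_step (Qnow : {set reg_state W}) vx vy
  : {ffun 'I_k -> T} -> {set reg_state W} -> Prop :=
| shield_pass :
    allowed Qnow (partition_input vx) (choice_of vx vy) ->
    shield_step Qnow vx vy vy
      (update Qnow (partition_input vx) (choice_of vx vy))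
| shield_override (c' : {set 'I_n}) (vy' : {ffun 'I_k -> T}) :
    ~ allowed Qnow (partition_input vx) (choice_of vx vy) ->
    allowed Qnow (partition_input vx) c' ->
    (forall r : env_prop,
       reaction_formula (val r) vx -> choice_formula c' vx vy') ->
    shield_step Qnow vx vy vy' (update Qnow (partition_input vx) c').

End Abstraction.

(* The external controller proposes an output from the trace so far and the
   current input. *)
Definition controller (Sg : signature) (T : theory Sg) (m k : nat) : Type :=
  seq (stateT T m k) -> {ffun 'I_m -> T} -> {ffun 'I_k -> T}.

Definition shielded_trace (Sg : signature) (T : theory Sg) (m k n : nat)
    (l : 'I_n -> literal Sg m k) (W : region (env_prop T l) 'I_n)
    (D : controller T m k) (sigma : nat -> stateT T m k) : Prop :=
  exists Qnow : nat -> {set reg_state W},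
    Qnow 0 = reg_init W /\
    forall i, shield_step (Qnow i) (sigma i).1
                (D (mkseq sigma i) (sigma i).1) (sigma i).2 (Qnow i.+1).

(* Main.v *)
(* The sets Q_now form a subset construction: every state of the (i+1)-st one has
   a predecessor in the i-th one along the move actually made, so runs of W
   labelled by the abstracted trace exist up to any length.  As W has finitely
   many states, König's lemma yields an infinite such run.  By soundness of W the
   abstracted trace satisfies the Boolean abstraction, and each s_i has there
   the truth value of l_i along the concrete trace. *)
Require Import Defs.
From mathcomp Require Import all_boot.
From mathcomp Require Import boolp.

Set Implicit Arguments.
Unset Strict Implicit.
Unset Printing Implicit Defensive.

(** If every [q] failed at some depth [b q], then, [P] being decreasing in depth, all would fail at
    the maximum of the [b q]. *)
Lemma finType_forall_exists_swap (Q : finType) (P : nat -> Q -> Prop) :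
  (forall d q, P d.+1 q -> P d q) -> (forall d, exists q, P d q) ->
  exists q, forall d, P d q.
Proof.
move=> Pdecr exP; apply: contrapT => noq.
have Ple d e q : d <= e -> P e q -> P d q.
  by move/subnK <-; elim: (e - d) => [|a IH] //= /Pdecr.
have /choice[b bP] q : exists d, ~ P d q.
  by apply/existsNP => allP; apply: noq; exists q.
have [q Pq] := exP (\max_q b q).
exact/(bP q)/(Ple _ _ _ _ Pq)/leq_bigmax.
Qed.

Section Konig.
Variables (Q : finType) (step : nat -> Q -> Q -> Prop).

Fixpoint extendible (d i : nat) (q : Q) : Prop :=
  if d is d'.+1 then exists q', step i q q' /\ extendible d' i.+1 q' else True.

Lemma extendible_pred d i q : extendible d.+1 i q -> extendible d i q.
Proof.
elim: d i q => [|d IH] i q //= [q' [st_q' ext_q']].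
by exists q'; split=> //; apply: IH.
Qed.

(** A state of [A i] may be a dead end, as only predecessors are assumed. Walking back [d] steps
    from [A (i + d)] still gives a state of [A i] extendible by [d] steps. The swap makes one
    initial state extendible to every depth, and applied again to successors it preserves this. *)
Lemma konig (A : nat -> {set Q}) :
  (forall i, exists q, q \in A i) ->
  (forall i q', q' \in A i.+1 -> exists2 q, q \in A i & step i q q') ->
  exists q : nat -> Q, q 0 \in A 0 /\ forall i, step i (q i) (q i.+1).
Proof.
move=> A_ne A_pred.
have A_ext d i : exists q, q \in A i /\ extendible d i q.
  elim: d i => [|d IH] i; first by have [q] := A_ne i; exists q.
  have [q' [/A_pred[q qA st] ext_q']] := IH i.+1.
  by exists q; split=> //; exists q'.
have [|q0 q0P] := @finType_forall_exists_swap Q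
    (fun d q => q \in A 0 /\ extendible d 0 q) _ (A_ext^~ 0).
  by move=> d q [qA /extendible_pred].
(* Choice needs a total relation, so extendibility is a premise inside it; where it fails, [iq.2] is
   a dummy value. *)
have /choice[next nextP] (iq : nat * Q) : exists q',
    (forall d, extendible d iq.1 iq.2) ->
    step iq.1 iq.2 q' /\ forall d, extendible d iq.1.+1 q'.
  have [ext|] := pselect (forall d, extendible d iq.1 iq.2); last first.
    by exists iq.2.
  have [||q' q'P] := @finType_forall_exists_swap Q
      (fun d q' => step iq.1 iq.2 q' /\ extendible d iq.1.+1 q').
  - by move=> d q [st /extendible_pred].
  - by move=> d; apply: (ext d.+1).
  by exists q' => _; split=> [|d]; [case: (q'P 0) | case: (q'P d)].
pose q := fix q i := if i is j.+1 then next (j, q j) else q0.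
have ext_q i d : extendible d i (q i).
  elim: i d => [|i IH] d; first by case: (q0P d).
  by have [_] := nextP (i, q i) IH; apply.
exists q; split=> [|i]; first by case: (q0P 0).
by have [] := nextP (i, q i) (ext_q i).
Qed.

End Konig.

Section Substitution.
Variables (A B : Type) (u : A -> ltl B).
Variables (tA : nat -> A -> Prop) (tB : nat -> B -> Prop).

Lemma ltl_sat_subst (f : ltl A) :
  (forall a i, ltl_occurs a f -> ltl_sat tB i (u a) <-> tA i a) ->
  forall i, ltl_sat tB i (ltl_subst u f) <-> ltl_sat tA i f.
Proof.
elim: f => [|a|g IHg|g IHg h IHh|g IHg|g IHg h IHh] //= uP i.
- exact: uP.
- by have := IHg uP i; tauto.
- have := IHg (fun a i o => uP a i (or_introl o)) i.
  by have := IHh (fun a i o => uP a i (or_intror o)) i; tauto.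
- exact: IHg.
have {}IHg := IHg (fun a i o => uP a i (or_introl o)).
have {}IHh := IHh (fun a i o => uP a i (or_intror o)).
by split=> -[j [ij /IHh hj gj]]; exists j; split=> // j' /gj /IHg.
Qed.

End Substitution.

Section Abstraction.
Variables (Sg : signature) (T : theory Sg) (m k n : nat).
Variable l : 'I_n -> literal Sg m k.
Implicit Types (vx : {ffun 'I_m -> T}) (vy : {ffun 'I_k -> T}).

(** The characteristic formula fixes the truth value of every literal, hence the choice. *)
Lemma choice_formula_choice_of c vx vy :
  choice_formula l c vx vy -> choice_of l vx vy = c.
Proof.
move=> [cP cNP]; apply/setP => i; rewrite inE.
by apply/asboolP/idP => [li|/cP //]; apply/negPn/negP => /cNP.
Qed.

(** The witness collects the choices realizable at [vx]; it is valid because [vx] itself satisfies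
    its formula. *)
Lemma ex_reaction_formula vx :
  exists r : env_prop T l, reaction_formula l (val r) vx.
Proof.
pose r := [set c | `[< exists vy, choice_formula l c vx vy >]].
have rP : reaction_formula l r vx.
  split=> c; rewrite inE; first by move/asboolP.
  by move/asboolP=> noc vy cP; apply: noc; exists vy.
have r_valid : `[< valid_reaction T l r >] by apply/asboolP; exists vx.
by exists (exist _ r r_valid).
Qed.

Definition abstract_state (st : stateT T m k) : stateB (env_prop T l) 'I_n :=
  (partition_input l st.1, choice_of l st.1 st.2).

Lemma satB_abstract (phi : ltlT Sg m k) (sigma : nat -> stateT T m k) :
  (forall a, ltl_occurs a phi -> exists i, l i = a) ->
  satB (abstract_state \o sigma) (ltl_subst (abstract_literal T l) phi) <->
  satT sigma phi.
Proof.
move=> phi_l; apply: ltl_sat_subst => a i /phi_l[j <-].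
(* The index [i'] picked satisfies [l i' = l j], so the truth values agree; [j] itself rules out the
   default [LFalse]. *)
rewrite /abstract_literal; case: pickP => [i' /asboolP eq_l|/(_ j)/asboolP //].
by rewrite /= inE -eq_l; split=> /asboolP.
Qed.

Variable W : region (env_prop T l) 'I_n.

(** When the shield overrides, some reaction holds at [vx], so the guard on [vy'] is discharged:
    [vy'] realizes [c'], and the emitted output abstracts to the very move used in the update. *)
Lemma shield_step_abstract (Qnow Qnext : {set reg_state W}) vx vy out :
  shield_step Qnow vx vy out Qnext ->
  let tau := abstract_state (vx, out) in
  allowed Qnow tau.1 tau.2 /\ Qnext = update Qnow tau.1 tau.2.
Proof.
case=> [// | c' vy' _ allowed_c' c'P] /=.
have [r /c'P /choice_formula_choice_of ->] := ex_reaction_formula vx.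
by split.
Qed.

Lemma shielded_trace_run (D : controller T m k) (sigma : nat -> stateT T m k) :
  shielded_trace W D sigma ->
  exists q : nat -> reg_state W,
    region_run q (abstract_state \o sigma).
Proof.
case=> Qnow [Q0 shield].
have {}shield i := shield_step_abstract (shield i).
(* Here [A] is [Qnow]: each set is nonempty because a move is allowed from it, and predecessors come
   from [update]. *)
rewrite /region_run -Q0; apply: (@konig _ (fun i q q' =>
  (q', (abstract_state (sigma i)).2) \in
    reg_trans q (abstract_state (sigma i)).1)) => [i|i q'].
  by have [[q [q' [qQ _]]] _] := shield i; exists q.
have [_ ->] := shield i.
by rewrite inE => /exists_inP[q qQ st]; exists q.
Qed.

End Abstraction.

Theorem theorem2 (Sg : signature) (T : theory Sg)
    (T_decidable : EA_decidable T)
    (m k n : nat) (l : 'I_n -> literal Sg m k) (l_inj : injective l)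
    (phi : ltlT Sg m k)
    (phi_literals : forall a : literal Sg m k,
       ltl_occurs a phi <-> exists i : 'I_n, l i = a)
    (phi_safety : safety (fun sigma : nat -> stateT T m k => satT sigma phi))
    (W : region (env_prop T l) 'I_n)
    (W_winning : winning_region (@legal_input Sg T m k n l)
                   (boolean_abstraction T l phi) W)
    (D : controller T m k) (sigma : nat -> stateT T m k) :
  shielded_trace W D sigma -> satT sigma phi.
Proof.
move=> /shielded_trace_run[q /(wr_sound W_winning)[sat_phi _]].
by apply: (satB_abstract (l := l) _ _).1 sat_phi => a /phi_literals.
Qed.
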